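(* Let $y\in L^2([0,1]^2)$ and suppose that $x^\dagger\in L^2([0,1]^2)$ is a solution to the autoconvolution equation $F(x)=y$ in the limited data case, i.e. $[x^\dagger*x^\dagger](s_1,s_2)=y(s_1,s_2)$ for almost every $(s_1,s_2)\in[0,1]^2$. Suppose moreover that $0\notin\operatorname{supp}(x^\dagger)$. Then there exist infinitely many other solutions $\hat{x}^\dagger\in L^2([0,1]^2)$ (pairwise distinct as elements of $L^2([0,1]^2)$ and different from $x^\dagger$) to the equation in the limited data case, i.e. with $[\hat{x}^\dagger*\hat{x}^\dagger](s_1,s_2)=y(s_1,s_2)$ for almost every $(s_1,s_2)\in[0,1]^2$.
   Context: All functions are real-valued, and $L^2$ spaces are with respect to Lebesgue measure $\lambda$. A function $x\in L^2([0,1]^2)$ is regarded as an element of $L^2(\mathbb{R}^2)$ with essential support $\operatorname{supp}(x)\subseteq[0,1]^2$ by extending it by zero. The limited data autoconvolution operator $F:L^2([0,1]^2)\to L^2([0,1]^2)$ is $F(x)=x*x$ restricted to $[0,1]^2$, i.e. for $0\le s_1,s_2\le1$ $$[F(x)](s_1,s_2)=\int_0^{s_2}\int_0^{s_1}x(s_1-t_1,s_2-t_2)\,x(t_1,t_2)\,dt_1\,dt_2 .$$ For given $y\in L^2([0,1]^2)$, a solution to $F(x)=y$ in the limited data case is a function $x\in L^2([0,1]^2)$ with $\operatorname{supp}(x)\subseteq[0,1]^2$ such that $[x*x](s_1,s_2)=y(s_1,s_2)$ for almost every $(s_1,s_2)\in[0,1]^2$. Here $0$ denotes the origin of $\mathbb{R}^2$,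 and $0\notin\operatorname{supp}(x)$ means that there is some radius $r>0$ such that $x(t_1,t_2)=0$ for almost every $(t_1,t_2)\in B_r(0)\cap[0,1]^2$, where $B_r(0)$ is the ball of radius $r$ around the origin. *)

(* Defs.v *)
(* MathComp-Analysis, for an arbitrary R : realType. *)
From HB Require Import structures.
From mathcomp Require Import all_boot all_order all_algebra.
From mathcomp Require Import all_classical all_reals all_analysis.
From mathcomp Require Import measurable_realfun ring.

Set Implicit Arguments.
Unset Strict Implicit.
Unset Printing Implicit Defensive.
Import Order.TTheory GRing.Theory Num.Theory.
Import numFieldNormedType.Exports.

Local Open Scope classical_set_scope.
Local Open Scope ring_scope.

Section autoconvolution.
Context (R : realType).

Local Notation plane := (measurableTypeR R * measurableTypeR R)%type.
Local Notation leb := (@lebesgue_measure R).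

Definition leb2 : {measure set plane -> \bar R} := (leb \x leb)%E.

Definition square : set plane := `[0, 1] `*` `[0, 1].

Lemma measurable_square : measurable square.
Proof. exact: measurableX. Qed.

Definition leb_square : {measure set plane -> \bar R} :=
  mrestr leb2 measurable_square.

(* The elements of L2([0,1]^2) are classes of Borel functions on the plane
   modulo almost everywhere equality on the square: the values of a
   representative outside the square carry no information. *)
Definition L2square := LspaceType2 leb_square.

Definition zero_ext (x : plane -> R) : plane -> R := patch (cst 0) square x.

Definition reflect2 (s t : plane) : plane := (s.1 - t.1, s.2 - t.2).

Definition conv (f g : plane -> R) (s : plane) : R :=
  \int[leb2]_t (f (reflect2 s t) * g t).

(* The operator F; only the values on the square are meaningful, and there they
   are given by the iterated integral of autoconvE below. *)
Definition autoconv (x : L2square) : plane -> R :=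
  conv (zero_ext x) (zero_ext x).

Definition is_solution (y x : L2square) : Prop :=
  autoconv x = y %[ae leb2 in square].

Definition disk (p : plane) (r : R) : set plane :=
  [set t | (t.1 - p.1) ^+ 2 + (t.2 - p.2) ^+ 2 < r ^+ 2].

Definition ess_supp (x : L2square) : set plane :=
  ~` [set p | exists2 r : R, 0 < r &
       {ae leb2, forall t, (disk p r `&` square) t -> x t = 0}].

Lemma L2square_eqP (f g : L2square) :
  f = g <-> (f : plane -> R) = g %[ae leb_square].
Proof.
split=> [->|]; first exact: aeW.
case: f => f [[hf]]; case: g => g [[hg]] /= h.
have /eqP e : (f == g %[mod {mfun_ leb_square, plane >-> measurableTypeR R}])%qT.
  by apply/ae_eqP; exact: h.
move: e; rewrite !reprK => e; subst g.
by have -> : hf = hg by exact: Prop_irrelevance.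
Qed.

Lemma measurable_reflect1 (a : R) :
  measurable_fun setT (fun t : measurableTypeR R => a - t : measurableTypeR R).
Proof. exact: measurable_realfun.measurable_funB. Qed.

Lemma leb_reflect (a : R) A : measurable A ->
  pushforward leb (fun t : measurableTypeR R => a - t : measurableTypeR R) A
  = leb A.
Proof.
move=> mA.
pose ph := fun t : measurableTypeR R => a - t : measurableTypeR R.
pose phm := isMeasurableFun.Build _ _ _ _ ph (measurable_reflect1 a).
pose php : {mfun _ >-> _} := HB.pack ph phm.
apply/esym/(@lebesgue_measure_unique _ (pushforward leb php)) => //= _ [[u v]] _ <-.
rewrite /pushforward /= (_ : ph @^-1` _ = [set` `[a - v, a - u[]); last first.
  apply/seteqP; split => t /=; rewrite !in_itv/= /ph => /andP[h1 h2].
    by rewrite lerBlDr addrC -lerBlDr h2/= ltrBrDr addrC -ltrBrDr.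
  by rewrite ltrBrDr addrC -ltrBrDr h2/= lerBlDr addrC -lerBlDr.
rewrite !lebesgue_measure_itv/= !lte_fin ltrD2l ltrN2.
by case: ifP => // _; congr (_%:E); ring.
Qed.

Lemma measurable_reflect2 s : measurable_fun setT (reflect2 s).
Proof.
apply/measurable_fun_pairP; split; rewrite /comp/=.
  by apply: (measurableT_comp (measurable_reflect1 s.1)).
by apply: (measurableT_comp (measurable_reflect1 s.2)).
Qed.

Lemma leb2_reflect s A : measurable A ->
  pushforward leb2 (reflect2 s) A = leb2 A.
Proof.
move=> mA.
pose phm := isMeasurableFun.Build _ _ _ _ (reflect2 s) (measurable_reflect2 s).
pose php : {mfun _ >-> _} := HB.pack (reflect2 s) phm.
apply/esym/(@product_measure_unique _ _ _ _ _ _ _ (pushforward leb2 php)) => //= B C mB mC.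
rewrite /pushforward /= (_ : reflect2 s @^-1` _ =
   ((fun t : measurableTypeR R => s.1 - t : measurableTypeR R) @^-1` B) `*`
   ((fun t : measurableTypeR R => s.2 - t : measurableTypeR R) @^-1` C))//.
rewrite [LHS]product_measure1E.
- by congr (_ * _)%E; exact: leb_reflect.
- by rewrite -[X in measurable X]setTI; exact: measurable_reflect1.
- by rewrite -[X in measurable X]setTI; exact: measurable_reflect1.
Qed.

Lemma L2_measurable (x : L2square) : measurable_fun [set: plane] (x : plane -> R).
Proof.
rewrite /aqEqMfun_to_fun.
by have := @measurable_funPT _ _ plane (measurableTypeR R) (repr (LebesgueSpace.sort x)).
Qed.

Lemma zero_ext_measurable (x : L2square) : measurable_fun setT (zero_ext x).
Proof.
rewrite /zero_ext (_ : patch _ _ _ = (x : plane -> R) \_ (square))//.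
apply/(measurable_restrictT _ (measurable_square)).
apply: measurable_funTS; exact: L2_measurable.
Qed.

Lemma zero_ext_L2 (x : L2square) :
  (\int[leb2]_t (zero_ext x t ^+ 2)%:E < +oo)%E.
Proof.
have ms := measurable_square.
have h : (\int[leb_square]_t ((x t : R) ^+ 2)%:E < +oo)%E.
  have mx : measurable_fun [set: plane] (x : plane -> R) by exact: L2_measurable.
  have xL : (x : plane -> R) \in Lfun (leb_square) 2%:E.
    rewrite inE; apply/andP; split; rewrite inE//=; exact: Lebesgue_finite.
  have /integrableP[_] := Lfun2_integrable_sqr xL.
  apply: le_lt_trans; apply: ge0_le_integral => //.
  - by move=> t _; rewrite lee_fin sqr_ge0.
  - by apply/measurable_EFinP; apply: measurable_funX.
  - by apply: measurableT_comp => //; apply/measurable_EFinP; apply: measurable_funX.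
  - by move=> t _; rewrite /= lee_fin ler_norm.
apply: le_lt_trans h.
have mx : measurable_fun [set: plane] (fun t : plane => ((x t : R) ^+ 2)%:E).
  by apply/measurable_EFinP; apply: measurable_funX; exact: L2_measurable.
apply: (@le_trans _ _ (\int[leb_square]_(t in square) ((x t : R) ^+ 2)%:E)%E); last first.
  by apply: ge0_subset_integral => // t _; rewrite lee_fin sqr_ge0.
rewrite le_eqVlt; apply/orP; left; apply/eqP.
rewrite -(@eq_measure_integral _ _ _ _ (leb_square) leb2); last first.
  by move=> A mA As; rewrite /leb_square /= /mrestr; congr (_ _); exact/esym/setIidl.
rewrite [RHS]integral_mkcond; apply: eq_integral => t _.
by rewrite /zero_ext /patch /=; case: ifP => //; rewrite expr0n.
Qed.

Lemma integrable_conv (x : L2square) s :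
  leb2.-integrable setT
   (fun t => (zero_ext x (reflect2 s t) * zero_ext x t)%:E).
Proof.
have mz := zero_ext_measurable x.
have mr : measurable_fun setT (zero_ext x \o reflect2 s).
  by apply: (measurableT_comp mz); exact: measurable_reflect2.
have m1 : measurable_fun setT (fun t => (zero_ext x t ^+ 2)%:E).
  by apply/measurable_EFinP; apply: measurable_funX.
have m2 : measurable_fun setT (fun t => (zero_ext x (reflect2 s t) ^+ 2)%:E).
  by apply/measurable_EFinP; apply: measurable_funX.
have h2 : (\int[leb2]_t (zero_ext x (reflect2 s t) ^+ 2)%:E < +oo)%E.
  have := @ge0_integral_pushforward _ _ _ _ _ _ (measurable_reflect2 s) leb2
    setT (fun t => (zero_ext x t ^+ 2)%:E) measurableT m1.
  rewrite preimage_setT /comp => <-; last by move=> t _; rewrite lee_fin sqr_ge0.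
  rewrite (eq_measure_integral leb2); first exact: zero_ext_L2.
  2: by move=> ? A mA _; exact: (leb2_reflect s mA).
  exact: measurable_reflect2.
apply/integrableP; split.
  by apply/measurable_EFinP; apply: measurable_funM.
have : (\int[leb2]_t ((zero_ext x (reflect2 s t) ^+ 2)%:E + (zero_ext x t ^+ 2)%:E) < +oo)%E.
  rewrite ge0_integralD//.
  - exact: lte_add_pinfty (zero_ext_L2 x).
  - by move=> t _; rewrite lee_fin sqr_ge0.
  - by move=> t _; rewrite lee_fin sqr_ge0.
apply: le_lt_trans; apply: ge0_le_integral => //.
- apply: measurableT_comp => //.
  by apply/measurable_EFinP; apply: measurable_funM.
- exact: emeasurable_funD.
- move=> t _; rewrite abse_EFin -EFinD lee_fin normrM.
  set a := zero_ext _ _; set b := zero_ext _ _.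
  rewrite -(real_normK (num_real a)) -(real_normK (num_real b)).
  have := sqr_ge0 (`|a| - `|b|); have : 0 <= `|a| * `|b| by rewrite mulr_ge0.
  rewrite sqrrB -[_ *+ 2]mulr_natr => h h'.
  rewrite -subr_ge0; apply: le_trans h' _; rewrite -subr_ge0.
  rewrite [X in 0 <= X](_ : _ = `|a| * `|b|)//; ring.
Qed.

Lemma autoconvE (x : L2square) s : square s ->
  autoconv x s =
  \int[leb]_(t2 in `[0, s.2]) \int[leb]_(t1 in `[0, s.1])
     (x (s.1 - t1, s.2 - t2) * x (t1, t2)).
Proof.
move=> [/= s1 s2]; have hi := integrable_conv x s.
transitivity (fine (\int[leb]_t2 \int[leb]_t1
   (zero_ext x (reflect2 s (t1, t2)) * zero_ext x (t1, t2))%:E)%E).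
  by congr fine; exact/esym/(integral21_prod_meas1 hi).
rewrite /Rintegral; congr fine.
rewrite [RHS]integral_mkcond.
have Gz t1 t2 : zero_ext x (reflect2 s (t1, t2)) * zero_ext x (t1, t2) =
  if (t2 \in `[0, s.2]) && (t1 \in `[0, s.1])
  then (x (s.1 - t1, s.2 - t2) : R) * x (t1, t2) else 0.
  move: s1 s2; rewrite /zero_ext /reflect2 /patch /= !in_itv/= => /andP[s10 s11] /andP[s20 s21].
  have E (p : plane) : (p \in square) = [&& 0 <= p.1 <= 1 & 0 <= p.2 <= 1].
    apply/idP/idP; first by rewrite inE => -[/=]; rewrite !in_itv/= => -> ->.
    by move=> /andP[h1 h2]; rewrite inE; split => /=; rewrite in_itv.
  rewrite !E/= !subr_ge0.
  have [t20|] := leP 0 t2; have [t2s|] := leP t2 s.2; rewrite ?andbF/= ?mul0r ?mulr0//.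
  have [t10|] := leP 0 t1; have [t1s|] := leP t1 s.1; rewrite ?andbF/= ?mul0r ?mulr0//.
  rewrite (le_trans t2s s21) (le_trans t1s s11)/=.
  by rewrite !lerBlDr (le_trans s11) ?lerDl// (le_trans s21) ?lerDl.
have Gi t2 : (\int[leb]_t1 ((zero_ext x (reflect2 s (t1, t2)) * zero_ext x (t1, t2))%R%:E)
  = ((fun t2 => \int[leb]_(t1 in `[0%R, s.1]) ((x (s.1 - t1, s.2 - t2) : R) * x (t1, t2))%R%:E) \_ `[0%R, s.2]) t2)%E.
  rewrite /patch mem_setE; have [ht|ht] := boolP (t2 \in `[0, s.2]).
    rewrite [RHS]integral_mkcond; apply: eq_integral => t1 _.
    by rewrite Gz ht /patch mem_setE/=; case: ifP.
  rewrite integral0_eq// => t1 _; by rewrite Gz (negbTE ht).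
set K := fun t2 => (\int[leb]_t1 ((zero_ext x (reflect2 s (t1, t2)) * zero_ext x (t1, t2))%R%:E))%E.
have mK : measurable_fun setT K by exact: (measurable_fubini_G hi).
transitivity (\int[leb]_t2 (fine (K t2))%:E)%E.
  apply: ae_eq_integral => //.
  - by apply/measurable_EFinP; exact: measurableT_comp.
  - have := ae_integrable2 hi; apply: filterS => t2 /= hf _.
    by rewrite fineK//; exact: (integrable_fin_num measurableT hf).
apply: eq_integral => t2 _; rewrite /K Gi /patch; case: ifP => //.
Qed.
End autoconvolution.

(* Main.v *)
Require Import Defs.
From HB Require Import structures.
From mathcomp Require Import all_boot all_order all_algebra.
From mathcomp Require Import all_classical all_reals all_analysis.
From mathcomp Require Import measurable_realfun lra.

(* Let x vanish a.e. on [0, e]^2 with e < 1/2, and let h be the indicator of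
   [1 - e, 1]^2. Then (x + c h) * (x + c h) = x * x on the unit square for every
   constant c: if t lies in [1 - e, 1]^2 and s in the square, then s - t has
   both coordinates at most e < 1 - e, so the cross terms and h * h vanish. *)

Set Implicit Arguments.
Unset Strict Implicit.
Unset Printing Implicit Defensive.
Import Order.TTheory GRing.Theory Num.Theory.

Local Open Scope classical_set_scope.
Local Open Scope ring_scope.

(** Transfers finiteness of the norm from a function to the representative chosen for its class. *)
Lemma finite_norm_ae_eq d (T : measurableType d) (R : realType)
    (mu : {measure set T -> \bar R}) (r : R) (f g : T -> R) :
  measurable_fun setT f -> measurable_fun setT g -> f = g %[ae mu] ->
  finite_norm mu r%:E f -> finite_norm mu r%:E g.
Proof.
move=> mf mg fg; rewrite /finite_norm unlock.
have mN (h : T -> R) : measurable_fun setT h ->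
    measurable_fun setT (fun t => `|(h t)%:E| `^ r)%E.
  move=> mh; apply/measurable_EFinP.
  by apply: (measurableT_comp (measurable_powR r)); exact: measurableT_comp.
rewrite (ae_eq_integral _ _ _ (mN _ mf) (mN _ mg))//.
by apply: filterS fg => t /[apply] /= ->.
Qed.

Section corner.
Context (R : realType).

Local Notation plane := (measurableTypeR R * measurableTypeR R)%type.
Local Notation leb := (@lebesgue_measure R).

Definition corner (e : R) : set plane := `[1 - e, 1] `*` `[1 - e, 1].

Lemma measurable_corner e : measurable (corner e).
Proof. exact: measurableX. Qed.

Lemma squareE (p : plane) :
  (p \in @square R) = [&& 0 <= p.1, p.1 <= 1, 0 <= p.2 & p.2 <= 1].
Proof.
apply/idP/idP.
  by rewrite inE => -[/=]; rewrite !in_itv/= => /andP[-> ->] /andP[-> ->].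
by move=> /and4P[h1 h2 h3 h4]; rewrite inE; split => /=; rewrite in_itv/=; apply/andP.
Qed.

Lemma cornerE e (p : plane) :
  (p \in corner e) = [&& 1 - e <= p.1, p.1 <= 1, 1 - e <= p.2 & p.2 <= 1].
Proof.
apply/idP/idP.
  by rewrite inE => -[/=]; rewrite !in_itv/= => /andP[-> ->] /andP[-> ->].
by move=> /and4P[h1 h2 h3 h4]; rewrite inE; split => /=; rewrite in_itv/=; apply/andP.
Qed.

Lemma corner_square e : e <= 1 -> corner e `<=` @square R.
Proof.
move=> e1 p /mem_set; rewrite cornerE => /and4P[a1 a2 b1 b2].
by apply: set_mem; rewrite squareE a2 b2 !andbT; apply/andP; split; lra.
Qed.

Lemma leb2_corner e : 0 < e -> leb2 R (corner e) = (e * e)%:E.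
Proof.
move=> e0; rewrite [LHS]product_measure1E//= lebesgue_measure_itv/=.
by rewrite lte_fin gtrBl e0 -EFinB -EFinM opprB addrC subrK.
Qed.

#[local] Instance ae_leb2_filter : Filter (almost_everywhere (leb2 R)).
Proof. exact: ae_filter_ringOfSetsType. Qed.

(** [leb_square] is the trace of [leb2] on the square, so its null sets meet the square in
    [leb2]-null sets. *)
Lemma ae_leb_square (P : plane -> Prop) :
  {ae leb_square R, forall t, P t} -> {ae leb2 R, forall t, square t -> P t}.
Proof.
move=> [N [mN N0 PN]]; exists (N `&` @square R); split.
- by apply: measurableI => //; exact: measurable_square.
- exact: N0.
- move=> t /= /not_implyP[st nP]; split => //; exact: PN.
Qed.

(** [reflect2 s] preserves [leb2], hence pulls null sets back to null sets. *)
Lemma ae_reflect2 s (P : plane -> Prop) :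
  {ae leb2 R, forall t, P t} -> {ae leb2 R, forall t, P (reflect2 s t)}.
Proof.
move=> [N [mN N0 PN]]; exists (reflect2 s @^-1` N); split.
- by rewrite -[X in measurable X]setTI; exact: measurable_reflect2.
- by rewrite -[LHS]/(pushforward (leb2 R) (reflect2 s) N) leb2_reflect.
- by move=> t /= nP; exact: PN.
Qed.

Lemma L2square_of_fun (f : plane -> R) : f \in Lfun (leb_square R) 2%:E ->
  exists g : L2square R, (g : plane -> R) = f %[ae leb_square R].
Proof.
move=> /andP[/[!inE] /= mf ff].
pose fm := isMeasurableFun.Build _ _ _ (measurableTypeR R) f mf.
pose F : {mfun plane >-> measurableTypeR R} := HB.pack f fm.
pose q : {mfun_ leb_square R, plane >-> measurableTypeR R} := (\pi F)%qT.
(* The representative of the quotient class [q] need not be [f]; the two agree only almost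
   everywhere. *)
have qf : (q : plane -> R) = f %[ae leb_square R].
  have /eqquotP/asboolP : (repr q = F %[mod {mfun_ leb_square R, plane >-> measurableTypeR R}])%qT.
    by rewrite reprK.
  exact.
have fq : finite_norm (leb_square R) 2%:E (q : plane -> R).
  apply: finite_norm_ae_eq ff => //.
  - exact: (@measurable_funPT _ _ plane (measurableTypeR R) (repr q)).
  - exact: ae_eq_sym.
pose qm := isFinLebesgue.Build _ _ _ (leb_square R) _ (lee1n 2) q fq.
pose g : L2square R := HB.pack q qm.
by exists g.
Qed.

Lemma L2square_Lfun (x : L2square R) :
  (x : plane -> R) \in Lfun (leb_square R) 2%:E.
Proof.
rewrite inE; apply/andP; split; rewrite inE//=.
- exact: L2_measurable.
- exact: Lebesgue_finite.
Qed.

Lemma indic_corner_Lfun e : 0 < e ->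
  (\1_(corner e) : plane -> R) \in Lfun (leb_square R) 2%:E.
Proof.
move=> e0; have mc := measurable_corner e.
rewrite inE; apply/andP; split; rewrite inE//=.
rewrite /finite_norm unlock poweR_lty//.
(* An indicator equals its own square, so the integral is the measure of the part of the corner
   inside the square. *)
under eq_integral => t _.
  rewrite /= [X in X%:E](_ : _ = \1_(corner e) t); last first.
    by rewrite indicE; case: (_ \in _); rewrite /= ?normr1 ?powR1// normr0 powR0.
  over.
rewrite integral_indic// setIT.
apply: (@le_lt_trans _ _ (leb2 R (corner e))); last by rewrite leb2_corner// ltry.
apply: (@le_measure _ _ _ (leb2 R) (corner e `&` @square R)).
- by rewrite inE; apply: measurableI => //; exact: measurable_square.
- by rewrite inE.
- exact: subIsetl.
Qed.

Lemma add_corner (x : L2square R) e c : 0 < e ->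
  exists z : L2square R,
    (z : plane -> R) = (fun t => x t + c * \1_(corner e) t) %[ae leb_square R].
Proof.
move=> e0; apply: L2square_of_fun.
rewrite (_ : (fun t => _) = c *: (\1_(corner e) : plane -> R) + (x : plane -> R)).
  exact: (Lfun_submod_closed _ (lee1n 2)).2 (indic_corner_Lfun e0) (L2square_Lfun x).
by apply/funext => t; rewrite addrC.
Qed.

(** If [c] and [d] differed, the two equalities could hold together only off the corner, which would
    then be null, against its measure [e * e]. The bound [e <= 1] puts the corner inside the square,
    where [leb_square] sees it. *)
Lemma add_corner_inj (x z : L2square R) e c d : 0 < e <= 1 ->
  (z : plane -> R) = (fun t => x t + c * \1_(corner e) t) %[ae leb_square R] ->
  (z : plane -> R) = (fun t => x t + d * \1_(corner e) t) %[ae leb_square R] ->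
  c = d.
Proof.
move=> /andP[e0 e1] zc zd; apply/eqP/negPn/negP => /eqP cd.
have : {ae leb2 R, forall t, ~ corner e t}.
  have H : {ae leb_square R, forall t, ~ corner e t}.
    apply: filterS2 zc zd => t /(_ I) h1 /(_ I) h2 /mem_set ct; apply: cd.
    by move: h2; rewrite h1 indicE ct !mulr1 => /addrI.
  apply: filterS (ae_leb_square H) => t h ct.
  by apply: (h _ ct); exact: corner_square ct.
rewrite /almost_everywhere/= => /negligibleP.
rewrite (_ : ~` _ = corner e); last by apply/seteqP; split => t /=; [move/contrapT|move=> ? ?].
move=> /(_ (measurable_corner e)) leb0.
have [/eqP] : (e * e)%:E = 0%:E by rewrite -leb2_corner//; exact: leb0.
by rewrite gt_eqF// mulr_gt0.
Qed.

(** For each fixed [s] in the square the two integrands agree for almost every [t], so the equality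
    holds at every such [s]. *)
Lemma autoconv_add_corner (x z : L2square R) e c s :
  0 < e -> e < 2^-1 ->
  {ae leb2 R, forall t, 0 <= t.1 <= e -> 0 <= t.2 <= e -> x t = 0} ->
  (z : plane -> R) = (fun t => x t + c * \1_(corner e) t) %[ae leb_square R] ->
  square s -> autoconv z s = autoconv x s.
Proof.
move=> e0 e2 x0 zE /mem_set; rewrite squareE => /and4P[s10 s11 s20 s21].
have e1 : e <= 1 by lra.
(* The lower bounds on [t] disappear because the extension is zero outside the square; this matters
   since [s - t] may have negative coordinates. *)
have zx0 : {ae leb2 R, forall t : plane, t.1 <= e -> t.2 <= e -> zero_ext x t = 0}.
  apply: filterS x0 => t h t1 t2; rewrite /zero_ext /patch squareE.
  by case: ifP => // /and4P[a1 _ a2 _]; apply: h; apply/andP.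
have zz : {ae leb2 R, forall t : plane,
    zero_ext z t = zero_ext x t + c * \1_(corner e) t}.
  apply: filterS (ae_leb_square zE) => t h; rewrite /zero_ext /patch.
  case: ifPn => [/set_mem/h ->//|ts].
  rewrite indicE memNset ?mulr0 ?addr0// => /(corner_square e1)/mem_set.
  exact/negP.
have mr (w : L2square R) : measurable_fun setT
    (fun t => (zero_ext w (reflect2 s t) * zero_ext w t)%:E).
  exact: measurable_int (integrable_conv w s).
rewrite /autoconv /conv /Rintegral; congr fine.
apply: ae_eq_integral => //.
(* Both facts are needed at [t] and at [s - t]. *)
apply: filterS2 (filterI zx0 (ae_reflect2 s zx0)) (filterI zz (ae_reflect2 s zz)).
move=> t [xt xr] [zt zr] _; congr EFin.
rewrite zt zr !indicE !cornerE.
(* If [t] is in the corner, [s - t] has coordinates at most [e < 1 - e]: it lies off the corner and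
   the extension of [x] vanishes there, so both products are zero. *)
have [/and4P[a1 a2 a3 a4]|_] := boolP [&& 1 - e <= t.1, _, _ & _].
  have r1 : s.1 - t.1 <= e by lra.
  have r2 : s.2 - t.2 <= e by lra.
  have -> : (1 - e <= (reflect2 s t).1) = false.
    by apply/negbTE; rewrite -ltNge /=; lra.
  by rewrite xr// mulr0 addr0 !mul0r.
(* Now [s - t] is in the corner and [t] is not; symmetrically [t] has coordinates at most [e], so
   the extension of [x] vanishes at [t]. *)
have [/and4P[a1 a2 a3 a4]|_] := boolP [&& _, _, _ & _].
  by rewrite xt ?mulr0 ?addr0 ?mulr0//; move: a1 a3; rewrite /=; lra.
by rewrite !mulr0 !addr0.
Qed.

Lemma ess_supp_origin (x : L2square R) : ~ ess_supp x (0, 0) ->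
  exists2 e : R, 0 < e < 2^-1 &
    {ae leb2 R, forall t, 0 <= t.1 <= e -> 0 <= t.2 <= e -> x t = 0}.
Proof.
(* The bound [r / 2] puts [[0, e]^2] inside the disk, as twice [(r / 2) ^+ 2] is less than [r ^+ 2];
   the bound 1/3 gives [e < 2^-1] and keeps it in the unit square. *)
move=> /contrapT[r r0 xr]; exists (Num.min (r / 2) 3^-1).
  by rewrite lt_min gt_min; apply/andP; split; [apply/andP; split|apply/orP; right]; lra.
apply: filterS xr => t h.
rewrite !le_min => /andP[a0 /andP[a1 a2]] /andP[b0 /andP[b1 b2]]; apply: h; split.
- rewrite /disk /= !subr0.
  have : t.1 ^+ 2 <= (r / 2) ^+ 2 by rewrite ler_pXn2r ?nnegrE//; lra.
  have : t.2 ^+ 2 <= (r / 2) ^+ 2 by rewrite ler_pXn2r ?nnegrE//; lra.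
  have : 0 < r ^+ 2 by rewrite exprn_gt0.
  rewrite expr_div_n; lra.
- by apply: set_mem; rewrite squareE; apply/and4P; split; lra.
Qed.

End corner.

Theorem theorem2 (R : realType) (y xdag : L2square R)
    (hsol : is_solution y xdag) (hsupp : ~ ess_supp xdag (0, 0)) :
  infinite_set [set xhat : L2square R | is_solution y xhat /\ xhat <> xdag].
Proof.
have [e /andP[e0 e2] x0] := ess_supp_origin hsupp.
have e1 : 0 < e <= 1 by rewrite e0/=; lra.
(* The coefficients start at 1, since 0 would give back [xdag]. *)
have [z zE] := choice (fun n : nat => add_corner xdag n.+1%:R e0).
have z_inj : injective z.
  move=> m n zmn; have := zE m; rewrite zmn => /(add_corner_inj e1)/(_ (zE n)).
  by move=> /eqP; rewrite eqr_nat eqSS => /eqP.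
apply/infiniteP/card_subP; exists (range z).
  by apply: inj_card_eq => m n _ _; exact: z_inj.
move=> _ [n _ <-] /=; split.
  apply: filterS hsol => s h ss.
  by rewrite (autoconv_add_corner e0 e2 x0 (zE n) ss) h.
(* [xdag] is its own perturbation with coefficient 0, so [z n = xdag] would force [n.+1%:R = 0]. *)
move=> zx; have := zE n; rewrite zx => /(@add_corner_inj _ _ _ _ _ 0 e1) h.
suff /eqP : n.+1%:R = 0 :> R by rewrite pnatr_eq0.
by apply: h; apply: aeW => t _; rewrite mul0r addr0.
Qed.
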